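(* Let $A$ be a regular (Noetherian) ring containing a field of characteristic $p>0$, and let $R=A[X_1,\ldots,X_n]$ be the standard $\mathbb{N}^n$-graded polynomial ring over $A$, i.e., $\deg(A)=\underline{0}\in\mathbb{N}^n$ and $\deg(X_j)=e_j\in\mathbb{N}^n$ for $j=1,\ldots,n$. Let $M=\bigoplus_{\underline{u}\in\mathbb{Z}^n}M_{\underline{u}}$ be a $\mathbb{Z}^n$-graded $\mathcal{F}$-finite $\mathcal{F}$-module over $R$. Let $U\subseteq\{1,\ldots,n\}$ be a subset and let $\mathcal{B}(U)=\{\underline{u}\in\mathbb{Z}^n\mid u_i\geq 0\text{ if }i\in U\text{ and }u_i\leq -1\text{ if }i\notin U\}$. Then the following are equivalent: (i) $M_{\underline{u}}\neq 0$ for all $\underline{u}\in\mathcal{B}(U)$; (ii) $M_{\underline{w}}\neq 0$ for some $\underline{w}\in\mathcal{B}(U)$.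
   Context: Here $e_j$ is the $j$-th standard basis vector of $\mathbb{Z}^n$. For a regular Noetherian ring $R$ of characteristic $p>0$, let $R^1$ be the $(R,R)$-bimodule which is $R$ as an additive group, with the usual left multiplication and with right multiplication through the Frobenius map $a\mapsto a^p$. The Frobenius functor is $\mathcal{F}(M)=R^1\otimes_R M$ on $R$-modules, with $\mathcal{F}(f)=\mathrm{id}\otimes f$; $\mathcal{F}^e$ denotes its $e$-th iterate. An $\mathcal{F}$-module over $R$ is an $R$-module $M$ with an $R$-module isomorphism $\theta:M\to\mathcal{F}(M)$. An $\mathcal{F}$-module is $\mathcal{F}$-finite if it is of the form $M=\varinjlim\left(U\xrightarrow{\beta}\mathcal{F}(U)\xrightarrow{\mathcal{F}(\beta)}\mathcal{F}^2(U)\to\cdots\right)$ for a finitely generated $R$-module $U$ and an $R$-linear map $\beta:U\to\mathcal{F}(U)$ (a generating morphism), with the structure isomorphism $M\cong\mathcal{F}(M)$ induced by shifting the direct system. If $R$ is $\mathbb{Z}^n$-graded and $M$ is a $\mathbb{Z}^n$-graded $R$-module, then $\mathcal{F}(M)$ is $\mathbb{Z}^n$-graded by $\deg(r\otimes m)=\deg(r)+p\deg(m)$ for homogeneous $r\in R$, $m\in M$. A $\mathbb{Z}^n$-graded $\mathcal{F}$-finite $\mathcal{F}$-module is one arising as such a direct limit with the finitely generated module graded and $\beta$ degree preserving, with the induced grading on $M$. *)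

(* Defs.v *)
From HB Require Import structures.
From mathcomp Require Import all_boot all_order all_algebra.
From mathcomp Require Import generic_quotient ring_quotient.
From mathcomp Require Import mpoly.
From mathcomp Require Import boolp.
From mathcomp Require Import ring.

Set Implicit Arguments.
Unset Strict Implicit.
Unset Printing Implicit Defensive.

Import Order.TTheory GRing.Theory Num.Theory.

Local Open Scope ring_scope.
Local Open Scope quotient_scope.

Section Ideals.
Variable L : comNzRingType.

Definition ideal_generated_by (s : seq L) (I : {pred L}) : Prop :=
  forall x, x \in I <-> exists c : 'I_(size s) -> L, x = \sum_i c i * s`_i.

(* [idealr_closed] ideals are proper; the unit ideal is generated by 1. *)
Definition noetherian : Prop :=
  forall I : {pred L}, idealr_closed I -> exists s, ideal_generated_by s I.

Definition prime_ideal (P : {pred L}) : Prop :=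
  idealr_closed P /\ prime_idealr_closed P.

Definition maximal_ideal (m : {pred L}) : Prop :=
  idealr_closed m /\
  forall I : {pred L}, idealr_closed I -> {subset m <= I} -> I =i m.

Definition local_ring_with (m : {pred L}) : Prop :=
  maximal_ideal m /\ forall m' : {pred L}, maximal_ideal m' -> m' =i m.

(* A strict chain Q 0 < Q 1 < ... < Q d of prime ideals. *)
Definition prime_chain (d : nat) : Prop :=
  exists Q : nat -> {pred L},
    (forall i, (i <= d)%N -> prime_ideal (Q i)) /\
    (forall i, (i < d)%N ->
       {subset Q i <= Q i.+1} /\ exists2 x, x \in Q i.+1 & x \notin Q i).

Definition krull_dim (d : nat) : Prop :=
  prime_chain d /\ forall d', prime_chain d' -> (d' <= d)%N.

Definition min_number_of_generators (I : {pred L}) (d : nat) : Prop :=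
  (exists2 s, size s = d & ideal_generated_by s I) /\
  forall s, ideal_generated_by s I -> (d <= size s)%N.

Definition regular_local_ring : Prop :=
  noetherian /\
  exists2 m, local_ring_with m &
    exists2 d, krull_dim d & min_number_of_generators m d.

End Ideals.

Section Localization.
Variables (A : comNzRingType) (P : prime_idealr A).

Definition denom := {s : A | s \notin (P : {pred A})}.

Lemma denom1_subproof : 1 \notin (P : {pred A}).
Proof. by rewrite idealr1. Qed.

Lemma denomM_subproof (s t : denom) : sval s * sval t \notin (P : {pred A}).
Proof. by rewrite prime_idealrM negb_or (valP s) (valP t). Qed.

Definition denom1 : denom :=
  exist (fun a : A => a \notin (P : {pred A})) 1 denom1_subproof.
Definition denomM (s t : denom) : denom :=
  exist (fun a : A => a \notin (P : {pred A})) _ (denomM_subproof s t).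

Definition loc_eq (x y : A * denom) : bool :=
  `[< exists u : denom, sval u * (x.1 * sval y.2) = sval u * (y.1 * sval x.2) >].

Lemma loc_eq_equiv : equiv_class_of loc_eq.
Proof.
split=> [x|x y|y x z].
- by apply/asboolP; exists denom1.
- by apply/asboolP/asboolP=> -[u hu]; exists u.
- move=> /asboolP[u hu] /asboolP[v hv]; apply/asboolP.
  exists (denomM (denomM u v) y.2) => /=.
  have -> : sval u * sval v * sval y.2 * (x.1 * sval z.2)
    = sval v * sval z.2 * (sval u * (x.1 * sval y.2)) by ring.
  rewrite hu.
  have -> : sval v * sval z.2 * (sval u * (y.1 * sval x.2))
    = sval u * sval x.2 * (sval v * (y.1 * sval z.2)) by ring.
  by rewrite hv; ring.
Qed.

Canonical loc_eq_equiv_rel := EquivRelPack loc_eq_equiv.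

Definition localization : Type := {eq_quot loc_eq}.

HB.instance Definition _ := Choice.on localization.
HB.instance Definition _ := Quotient.on localization.
HB.instance Definition _ := EqQuotient.on localization.

Definition frac (x : A * denom) : localization := \pi_localization x.

Lemma fracW (Q : localization -> Prop) : (forall x, Q (frac x)) -> forall q, Q q.
Proof. exact: quotW. Qed.

Lemma repr_frac q : frac (repr q) = q. Proof. exact: reprK. Qed.

Lemma fracP (x y : A * denom) :
  frac x = frac y <->
  exists u : denom, sval u * (x.1 * sval y.2) = sval u * (y.1 * sval x.2).
Proof.
split; first by move=> /eqmodP /asboolP.
by move=> h; apply/eqmodP/asboolP.
Qed.

Definition loc_add (q r : localization) : localization :=
  let x := repr q in let y := repr r in
  frac (x.1 * sval y.2 + y.1 * sval x.2, denomM x.2 y.2).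
Definition loc_opp (q : localization) : localization :=
  frac (- (repr q).1, (repr q).2).
Definition loc_mul (q r : localization) : localization :=
  let x := repr q in let y := repr r in frac (x.1 * y.1, denomM x.2 y.2).

Lemma loc_addE x y :
  loc_add (frac x) (frac y)
  = frac (x.1 * sval y.2 + y.1 * sval x.2, denomM x.2 y.2).
Proof.
rewrite /loc_add; apply/fracP=> /=.
have /fracP[u hu] := repr_frac (frac x); have /fracP[v hv] := repr_frac (frac y).
move: (repr (frac x)) (repr (frac y)) hu hv => x' y' hu hv.
exists (denomM u v) => /=.
have -> : sval u * sval v * ((x'.1 * sval y'.2 + y'.1 * sval x'.2) *
    (sval x.2 * sval y.2)) =
  sval v * sval y'.2 * sval y.2 * (sval u * (x'.1 * sval x.2)) +
  sval u * sval x'.2 * sval x.2 * (sval v * (y'.1 * sval y.2)) by ring.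
by rewrite hu hv; ring.
Qed.

Lemma loc_oppE x : loc_opp (frac x) = frac (- x.1, x.2).
Proof.
rewrite /loc_opp; apply/fracP=> /=.
have /fracP[u hu] := repr_frac (frac x); exists u.
by rewrite !mulNr !mulrN hu.
Qed.

Lemma loc_mulE x y :
  loc_mul (frac x) (frac y) = frac (x.1 * y.1, denomM x.2 y.2).
Proof.
rewrite /loc_mul; apply/fracP=> /=.
have /fracP[u hu] := repr_frac (frac x); have /fracP[v hv] := repr_frac (frac y).
move: (repr (frac x)) (repr (frac y)) hu hv => x' y' hu hv.
exists (denomM u v) => /=.
have -> : sval u * sval v * (x'.1 * y'.1 * (sval x.2 * sval y.2)) =
  sval u * (x'.1 * sval x.2) * (sval v * (y'.1 * sval y.2)) by ring.
by rewrite hu hv; ring.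
Qed.

Let loc0 : localization := frac (0, denom1).
Let loc1 : localization := frac (1, denom1).

Lemma frac_eqI x y : x.1 * sval y.2 = y.1 * sval x.2 -> frac x = frac y.
Proof. by move=> h; apply/fracP; exists denom1; rewrite h. Qed.

Lemma loc_addA : associative loc_add.
Proof.
elim/fracW=> x; elim/fracW=> y; elim/fracW=> z.
by rewrite !loc_addE; apply: frac_eqI => /=; ring.
Qed.
Lemma loc_addC : commutative loc_add.
Proof.
elim/fracW=> x; elim/fracW=> y.
by rewrite !loc_addE; apply: frac_eqI => /=; ring.
Qed.
Lemma loc_add0 : left_id loc0 loc_add.
Proof. by elim/fracW=> x; rewrite loc_addE; apply: frac_eqI => /=; ring. Qed.
Lemma loc_addN : left_inverse loc0 loc_opp loc_add.
Proof.
by elim/fracW=> x; rewrite loc_oppE loc_addE; apply: frac_eqI => /=; ring.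
Qed.

HB.instance Definition _ :=
  GRing.isZmodule.Build localization loc_addA loc_addC loc_add0 loc_addN.

Lemma loc_mulA : associative loc_mul.
Proof.
elim/fracW=> x; elim/fracW=> y; elim/fracW=> z.
by rewrite !loc_mulE; apply: frac_eqI => /=; ring.
Qed.
Lemma loc_mulC : commutative loc_mul.
Proof.
elim/fracW=> x; elim/fracW=> y.
by rewrite !loc_mulE; apply: frac_eqI => /=; ring.
Qed.
Lemma loc_mul1 : left_id loc1 loc_mul.
Proof. by elim/fracW=> x; rewrite loc_mulE; apply: frac_eqI => /=; ring. Qed.
Lemma loc_mulDl : left_distributive loc_mul loc_add.
Proof.
elim/fracW=> x; elim/fracW=> y; elim/fracW=> z.
by rewrite !(loc_addE, loc_mulE); apply: frac_eqI => /=; ring.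
Qed.
Lemma loc1_neq0 : loc1 != 0.
Proof.
apply/eqP => /fracP[u] /=; rewrite mul0r mulr0 !mulr1 => u0.
by move: (valP u); rewrite (u0 : val u = 0) idealr0.
Qed.

HB.instance Definition _ := GRing.Zmodule_isComNzRing.Build localization
  loc_mulA loc_mulC loc_mul1 loc_mulDl loc1_neq0.

End Localization.

Definition regular_ring (A : comNzRingType) : Prop :=
  noetherian A /\
  forall P : prime_idealr A, regular_local_ring (localization P : comNzRingType).

Section Presentation.
Variables (R : comNzRingType) (G : choiceType).
Variable rel : seq (R * G) -> seq (R * G) -> Prop.
Implicit Types (s t : seq (R * G)).

Definition scale_sum (a : R) s := [seq (a * x.1, x.2) | x <- s].

(* The sequence [:: (a_1, g_1); ...; (a_k, g_k)] stands for the element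
   a_1 g_1 + ... + a_k g_k of the free module on G. *)
Inductive pres_cong : seq (R * G) -> seq (R * G) -> Prop :=
| pres_rel s t : rel s t -> pres_cong s t
| pres_refl s : pres_cong s s
| pres_sym s t : pres_cong s t -> pres_cong t s
| pres_trans s t u : pres_cong s t -> pres_cong t u -> pres_cong s u
| pres_cat s s' t t' :
    pres_cong s s' -> pres_cong t t' -> pres_cong (s ++ t) (s' ++ t')
| pres_comm s t : pres_cong (s ++ t) (t ++ s)
| pres_scale a s t :
    pres_cong s t -> pres_cong (scale_sum a s) (scale_sum a t)
| pres_add a b g : pres_cong [:: (a + b, g)] [:: (a, g); (b, g)]
| pres_zero g : pres_cong [:: (0, g)] [::].

Definition pres_eq s t : bool := `[< pres_cong s t >].

Lemma pres_eq_equiv : equiv_class_of pres_eq.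
Proof.
split=> [s|s t|t s u].
- exact/asboolP/pres_refl.
- by apply/asboolP/asboolP; exact: pres_sym.
- by move=> /asboolP st /asboolP tu; exact/asboolP/(pres_trans st tu).
Qed.

Canonical pres_eq_equiv_rel := EquivRelPack pres_eq_equiv.

Definition presmod : Type := {eq_quot pres_eq}.

HB.instance Definition _ := Choice.on presmod.
HB.instance Definition _ := Quotient.on presmod.
HB.instance Definition _ := EqQuotient.on presmod.

Definition pres_class s : presmod := \pi_presmod s.

Lemma pres_classP s t : pres_class s = pres_class t <-> pres_cong s t.
Proof.
split; first by move=> /eqmodP /asboolP.
by move=> h; apply/eqmodP/asboolP.
Qed.

Lemma presW (Q : presmod -> Prop) :
  (forall s, Q (pres_class s)) -> forall x, Q x.
Proof. exact: quotW. Qed.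

Lemma pres_repr s : pres_cong (repr (pres_class s)) s.
Proof. by apply/pres_classP; rewrite /pres_class reprK. Qed.

Definition presmod_add (x y : presmod) : presmod :=
  pres_class (repr x ++ repr y).
Definition presmod_scale (a : R) (x : presmod) : presmod :=
  pres_class (scale_sum a (repr x)).
Definition presmod_opp (x : presmod) : presmod := presmod_scale (- 1) x.

Lemma presmod_addE s t :
  presmod_add (pres_class s) (pres_class t) = pres_class (s ++ t).
Proof. by apply/pres_classP; apply: pres_cat; exact: pres_repr. Qed.

Lemma presmod_scaleE a s :
  presmod_scale a (pres_class s) = pres_class (scale_sum a s).
Proof. by apply/pres_classP; apply: pres_scale; exact: pres_repr. Qed.

Lemma presmod_addA : associative presmod_add.
Proof.
by elim/presW=> s; elim/presW=> t; elim/presW=> u; rewrite !presmod_addE catA.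
Qed.
Lemma presmod_addC : commutative presmod_add.
Proof.
elim/presW=> s; elim/presW=> t; rewrite !presmod_addE.
exact/pres_classP/pres_comm.
Qed.
Lemma presmod_add0 : left_id (pres_class [::]) presmod_add.
Proof. by elim/presW=> s; rewrite presmod_addE. Qed.

Lemma presmod_scaleDl x a b :
  presmod_scale (a + b) x = presmod_add (presmod_scale a x) (presmod_scale b x).
Proof.
elim/presW: x => s; rewrite !presmod_scaleE presmod_addE; apply/pres_classP.
elim: s => [|[c g] s IHs] /=; first exact: pres_refl.
rewrite mulrDl.
apply: (pres_trans (pres_cat (pres_add (a * c) (b * c) g) IHs)).
have := pres_cat (pres_refl [:: (a * c, g)])
  (pres_cat (pres_comm [:: (b * c, g)] (scale_sum a s))
            (pres_refl (scale_sum b s))).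
by rewrite -[(scale_sum a s ++ _) ++ _]catA.
Qed.

Lemma presmod_scale0 x : presmod_scale 0 x = pres_class [::].
Proof.
elim/presW: x => s; rewrite presmod_scaleE; apply/pres_classP.
elim: s => [|[c g] s IHs] /=; first exact: pres_refl.
by rewrite mul0r; exact: (pres_cat (pres_zero g) IHs).
Qed.

Lemma presmod_scale1 : left_id 1 presmod_scale.
Proof.
elim/presW=> s; rewrite presmod_scaleE; congr pres_class.
by elim: s => [|[c g] s /= ->] //=; rewrite mul1r.
Qed.

Lemma presmod_addN : left_inverse (pres_class [::]) presmod_opp presmod_add.
Proof.
move=> x; rewrite /presmod_opp -[X in presmod_add _ X]presmod_scale1.
by rewrite -presmod_scaleDl addNr presmod_scale0.
Qed.

HB.instance Definition _ := GRing.isZmodule.Build presmod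
  presmod_addA presmod_addC presmod_add0 presmod_addN.

Lemma presmod_scaleA a b x :
  presmod_scale a (presmod_scale b x) = presmod_scale (a * b) x.
Proof.
elim/presW: x => s; rewrite !presmod_scaleE; congr pres_class.
by elim: s => [|[c g] s /= ->] //=; rewrite mulrA.
Qed.

Lemma presmod_scaleDr : right_distributive presmod_scale +%R.
Proof.
move=> a; elim/presW=> s; elim/presW=> t.
by rewrite /GRing.add /= presmod_addE !presmod_scaleE presmod_addE /scale_sum map_cat.
Qed.

HB.instance Definition _ := GRing.Zmodule_isLmodule.Build R presmod
  presmod_scaleA presmod_scale1 presmod_scaleDr (fun x a b => presmod_scaleDl x a b).

Lemma pres_class_nil : pres_class [::] = 0. Proof. by []. Qed.
Lemma pres_class_cat s t : pres_class (s ++ t) = pres_class s + pres_class t.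
Proof. by rewrite /GRing.add /= presmod_addE. Qed.
Lemma pres_class_scale a s : pres_class (scale_sum a s) = a *: pres_class s.
Proof. by rewrite /GRing.scale /= presmod_scaleE. Qed.

Section Lift.
Variables (N : lmodType R) (h : G -> N).

Definition eval_sum s : N := \sum_(x <- s) x.1 *: h x.2.

Hypothesis h_rel : forall s t, rel s t -> eval_sum s = eval_sum t.

Lemma eval_sum_scale a s : eval_sum (scale_sum a s) = a *: eval_sum s.
Proof.
rewrite /eval_sum big_map scaler_sumr.
by apply: eq_bigr => x _; rewrite scalerA.
Qed.

Lemma eval_sum_cong s t : pres_cong s t -> eval_sum s = eval_sum t.
Proof.
elim=> {s t} [s t|s|s t _ ->|s t u _ -> _ ->|s s1 t t1 _ hs _ ht|s t|a s t _ hst|a b g|g] //.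
- exact: h_rel.
- by move: hs ht; rewrite /eval_sum !big_cat /= => -> ->.
- by rewrite /eval_sum !big_cat /= addrC.
- by rewrite !eval_sum_scale hst.
- by rewrite /eval_sum !(big_cons, big_nil) /= scalerDl !addr0.
- by rewrite /eval_sum !(big_cons, big_nil) /= scale0r addr0.
Qed.

Definition pres_lift_fun of (forall s t, rel s t -> eval_sum s = eval_sum t) :=
  fun x : presmod => eval_sum (repr x).

Local Notation lift := (pres_lift_fun h_rel).

Lemma pres_lift_class s : lift (pres_class s) = eval_sum s.
Proof. exact/eval_sum_cong/pres_repr. Qed.

Lemma pres_lift_linear : linear lift.
Proof.
move=> a; elim/presW=> s; elim/presW=> t.
rewrite -pres_class_scale -pres_class_cat !pres_lift_class.
by rewrite /eval_sum big_cat /= -/(eval_sum _) eval_sum_scale.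
Qed.

HB.instance Definition _ :=
  GRing.isLinear.Build R presmod N *:%R lift pres_lift_linear.

Definition pres_lift : {linear presmod -> N} := lift.

End Lift.
End Presentation.

Section ExtensionOfScalars.
Variables (R S : comNzRingType) (phi : {rmorphism R -> S}).

(* Additivity and S-linearity in the first factor are part of [presmod]. *)
Inductive tensor_rel (M : lmodType R) : seq (S * M) -> seq (S * M) -> Prop :=
| tensor_addr s m m' :
    tensor_rel [:: (s, m + m')] [:: (s, m); (s, m')]
| tensor_balanced s a m :
    tensor_rel [:: (s * phi a, m)] [:: (s, a *: m)].

(* S (x)_R M, where R acts on the right of S through phi. *)
Definition tensor (M : lmodType R) : lmodType S := presmod (@tensor_rel M).

Definition pure_tensor (M : lmodType R) (s : S) (m : M) : tensor M :=
  pres_class (@tensor_rel M) [:: (s, m)].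

Lemma tensor_map_subproof (M N : lmodType R) (f : {linear M -> N}) s t :
  tensor_rel s t ->
  eval_sum (N := tensor N) (fun m => pure_tensor 1 (f m)) s
  = eval_sum (N := tensor N) (fun m => pure_tensor 1 (f m)) t.
Proof.
have pureE a (n : N) : a *: pure_tensor 1 n = pure_tensor a n.
  by rewrite /pure_tensor -pres_class_scale /= mulr1.
have pureD a (n n' : N) :
    pure_tensor a (n + n') = pure_tensor a n + pure_tensor a n'.
  by rewrite /pure_tensor -pres_class_cat; exact/pres_classP/pres_rel/tensor_addr.
case=> [a m m'|a b m]; rewrite /eval_sum !(big_cons, big_nil) /= !addr0 !pureE.
  by rewrite linearD pureD.
rewrite linearZ_LR.
exact/pres_classP/pres_rel/tensor_balanced.
Qed.

Definition tensor_map (M N : lmodType R) (f : {linear M -> N}) :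
    {linear tensor M -> tensor N} :=
  pres_lift (@tensor_map_subproof M N f).

Lemma tensor_mapE (M N : lmodType R) (f : {linear M -> N}) s m :
  tensor_map f (pure_tensor s m) = pure_tensor s (f m).
Proof.
rewrite /tensor_map /pres_lift /= /pure_tensor pres_lift_class /eval_sum.
by rewrite big_cons big_nil addr0 -pres_class_scale /= mulr1.
Qed.

End ExtensionOfScalars.

Section DirectLimit.
Variables (R : comNzRingType) (E : nat -> lmodType R).
Variable f : forall e, {linear E e -> E e.+1}.

Definition level_elt (e : nat) (x : E e) : {e : nat & E e} := existT _ e x.

Inductive dirlim_rel :
    seq (R * {e : nat & E e}) -> seq (R * {e : nat & E e}) -> Prop :=
| dirlim_add e (x y : E e) :
    dirlim_rel [:: (1, level_elt (x + y))]
               [:: (1, level_elt x); (1, level_elt y)]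
| dirlim_scale a e (x : E e) :
    dirlim_rel [:: (1, level_elt (a *: x))] [:: (a, level_elt x)]
| dirlim_step e (x : E e) :
    dirlim_rel [:: (1, level_elt x)] [:: (1, level_elt (f e x))].

Definition dirlim : lmodType R := presmod dirlim_rel.

Definition dirlim_in_fun (e : nat) (x : E e) : dirlim :=
  pres_class dirlim_rel [:: (1, level_elt x)].

Lemma dirlim_in_linear e : linear (@dirlim_in_fun e).
Proof.
move=> a x y; rewrite /dirlim_in_fun -pres_class_scale -pres_class_cat /= mulr1.
apply/pres_classP; apply: (pres_trans (pres_rel (dirlim_add _ _))).
exact: (pres_cat (pres_rel (dirlim_scale _ _)) (pres_refl _ [:: _])).
Qed.

HB.instance Definition _ e :=
  GRing.isLinear.Build R (E e) dirlim *:%R (@dirlim_in_fun e) (@dirlim_in_linear e).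

Definition dirlim_in (e : nat) : {linear E e -> dirlim} := @dirlim_in_fun e.

End DirectLimit.

Section FModules.
Variables (R : comNzRingType) (p : nat) (hp : p \in [pchar R]).

Definition Frob (M : lmodType R) : lmodType R := tensor (pFrobenius_aut hp) M.

Definition Frob_map (M N : lmodType R) (f : {linear M -> N}) :
    {linear Frob M -> Frob N} := tensor_map (pFrobenius_aut hp) f.

Fixpoint Frob_iter (e : nat) (U : lmodType R) : lmodType R :=
  if e is e'.+1 then Frob (Frob_iter e' U) else U.

Fixpoint Frob_iter_map (U : lmodType R) (beta : {linear U -> Frob U}) (e : nat) :
    {linear Frob_iter e U -> Frob_iter e.+1 U} :=
  if e is e'.+1 then Frob_map (Frob_iter_map beta e') else beta.

Definition Frob_lim (U : lmodType R) (beta : {linear U -> Frob U}) : lmodType R :=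
  dirlim (Frob_iter_map beta).

Definition Frob_lim_in (U : lmodType R) (beta : {linear U -> Frob U}) (e : nat) :
    {linear Frob_iter e U -> Frob_lim beta} :=
  dirlim_in (Frob_iter_map beta) e.

Record Fmodule := FModule {
  Fmod_carrier :> lmodType R;
  Fmod_theta : {linear Fmod_carrier -> Frob Fmod_carrier};
  Fmod_theta_bij : bijective Fmod_theta
}.

Definition finitely_generated (U : lmodType R) : Prop :=
  exists s : seq U, forall x, exists c : 'I_(size s) -> R,
    x = \sum_i c i *: s`_i.

End FModules.

Notation multideg n := {ffun 'I_n -> int}.

Section Gradings.
Variables (n : nat) (R : comNzRingType) (gR : multideg n -> R -> Prop).

(* [gM u m] means that m lies in the component M_u. *)
Record graded_module (M : lmodType R) (gM : multideg n -> M -> Prop) : Prop := {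
  graded_zero : forall u, gM u 0;
  graded_sub : forall u x y, gM u x -> gM u y -> gM u (x - y);
  graded_action : forall u v r x, gR u r -> gM v x -> gM (u + v) (r *: x);
  graded_span : forall x, exists (s : seq (multideg n)) (c : multideg n -> M),
    [/\ uniq s, (forall u, gM u (c u)) & x = \sum_(u <- s) c u];
  graded_indep : forall (s : seq (multideg n)) (c : multideg n -> M),
    uniq s -> (forall u, gM u (c u)) -> \sum_(u <- s) c u = 0 ->
    forall u, u \in s -> c u = 0
}.

Definition degree_preserving (M N : lmodType R) (gM : multideg n -> M -> Prop)
    (gN : multideg n -> N -> Prop) (f : {linear M -> N}) : Prop :=
  forall u x, gM u x -> gN u (f x).

Variables (p : nat) (hp : p \in [pchar R]).

Definition Frob_grading (M : lmodType R) (gM : multideg n -> M -> Prop)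
    (u : multideg n) (x : Frob hp M) : Prop :=
  exists s : seq (R * M),
    (forall y, y \in s ->
       exists a b, [/\ gR a y.1, gM b y.2 & u = a + b *+ p]) /\
    x = \sum_(y <- s) pure_tensor (pFrobenius_aut hp) y.1 y.2.

Fixpoint Frob_iter_grading (U : lmodType R) (gU : multideg n -> U -> Prop)
    (e : nat) : multideg n -> Frob_iter hp e U -> Prop :=
  if e is e'.+1 then Frob_grading (Frob_iter_grading gU (e := e')) else gU.

Definition graded_F_finite (M : Fmodule hp) (gM : multideg n -> M -> Prop) :
    Prop :=
  graded_module gM /\
  exists (U : lmodType R) (gU : multideg n -> U -> Prop)
         (beta : {linear U -> Frob hp U}),
    [/\ finitely_generated U, graded_module gU,
        degree_preserving gU (Frob_grading gU) beta &
    exists phi : {linear Frob_lim beta -> M},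
      [/\ bijective phi,
          (* the structure isomorphism is the shift of the direct system *)
          forall e (x : Frob_iter hp e.+1 U),
            Fmod_theta M (phi (Frob_lim_in beta e.+1 x))
            = Frob_map hp (phi \o Frob_lim_in beta e) x &
          forall u m, gM u m <->
            exists e (x : Frob_iter hp e U),
              Frob_iter_grading gU u x /\ m = phi (Frob_lim_in beta e x)]].

End Gradings.

Section Polynomial.
Variables (A : comNzRingType) (n : nat).

Definition mnm_deg (m : 'X_{1..n}) : multideg n := [ffun i => (m i)%:Z].

Definition mpoly_grading (u : multideg n) (f : {mpoly A[n]}) : Prop :=
  forall m, m \in msupp f -> mnm_deg m = u.

Lemma pchar_mpoly (k : fieldType) (p : nat) (iota : {rmorphism k -> A}) :
  p \in [pchar k] -> p \in [pchar {mpoly A[n]}].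
Proof.
move=> hk; apply/andP; split; first exact: pcharf_prime hk.
by rewrite -mpolyC_nat -(rmorph_nat iota) (pcharf0 hk) rmorph0 mpolyC0.
Qed.

End Polynomial.

Definition nonzero_component (n : nat) (V : zmodType)
    (gM : multideg n -> V -> Prop) (u : multideg n) : Prop :=
  exists2 m, gM u m & m <> 0.

Definition block (n : nat) (W : {set 'I_n}) (u : multideg n) : Prop :=
  forall i, if i \in W then 0 <= u i else u i <= -1.

(* Main.v *)
Require Import Defs.
From mathcomp Require Import all_boot all_order all_algebra.
From mathcomp Require Import ssrcomplements mpoly.
From mathcomp Require Import boolp zify.

(** Write phi : M -> M for the Frobenius-linear map theta^-1 (1 (x) m).
    Bijectivity of theta says that M is the universal target r *: phi m of the
    biadditive maps B with B (r * a ^+ p) m = B r (a *: m), and iterating gives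
    the same for phi^e and q = p ^ e ([Fmod_frob_sum_eq0]).  In other words
    M = F^e(M), where F^e is extension of scalars along a |-> a ^+ q; the
    universal property replaces iterated tensor products.

    The grading of M comes from the direct system, so phi multiplies degrees by
    p and M_u is spanned by the f *: phi^e m with deg f + q deg m = u
    ([Fmod_frob_iter_span]).  Over a polynomial ring the residues mod q of the
    exponents of f are then those of u, so the component only depends on the
    floor of u / q: if u = r + q b and u' = r' + q b with the entries of r and
    r' in [0, q), replacing the residue r by r' in every exponent is additive
    and linear over q-th powers, hence induces a map M_u -> M_u', and the same
    construction from r' to r is its inverse ([nonzero_component_congr]).

    Finally, for q larger than all |u_i|, every u of the block of W is r + q b
    with b the corner of the block (0 on W, -1 elsewhere), so any two degrees
    of a block are compared by a single large e ([block_digits]).  Every block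
    contains its corner, which gives the converse implication. *)

Set Implicit Arguments.
Unset Strict Implicit.
Unset Printing Implicit Defensive.

Import Order.TTheory GRing.Theory Num.Theory.

(** * Biadditive maps balanced along a power map *)

Section BalancedMaps.
Local Open Scope ring_scope.
Variables (R : comNzRingType) (M : lmodType R) (V : zmodType).

Record balanced (q : nat) (B : R -> M -> V) : Prop := {
  balancedDl : forall r s m, B (r + s) m = B r m + B s m;
  balancedDr : forall r m m', B r (m + m') = B r m + B r m';
  balancedZ : forall r a m, B (r * a ^+ q) m = B r (a *: m)
}.

Variables (q : nat) (B : R -> M -> V).
Hypothesis balB : balanced q B.

Lemma balanced0l m : B 0 m = 0.
Proof. by apply: (addrI (B 0 m)); rewrite -(balancedDl balB) !addr0. Qed.

Lemma balanced0r r : B r 0 = 0.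
Proof. by apply: (addrI (B r 0)); rewrite -(balancedDr balB) !addr0. Qed.

End BalancedMaps.

(** * The Frobenius-linear map of an F-module *)

Section FrobeniusStructure.
Local Open Scope ring_scope.
Variables (R : comNzRingType) (p : nat) (hp : p \in [pchar R]).

Lemma pure_tensorZ (M : lmodType R) a r (m : M) :
  a *: pure_tensor (pFrobenius_aut hp) r m
  = pure_tensor (pFrobenius_aut hp) (a * r) m.
Proof. by rewrite /pure_tensor -pres_class_scale. Qed.

(** The presentation of the tensor product is closed under R-scaling, while B is
    not linear in its first variable; the factor c makes the induction pass
    through that closure rule. *)
Lemma balanced_sum_cong (M : lmodType R) (V : zmodType) (B : R -> M -> V) s t :
  balanced p B -> pres_cong (@tensor_rel _ _ (pFrobenius_aut hp) M) s t ->
  forall c, \sum_(x <- s) B (c * x.1) x.2 = \sum_(x <- t) B (c * x.1) x.2.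
Proof.
move=> balB; elim=> {s t}.
- move=> s t [r m m'|r a m] c; rewrite !(big_cons, big_nil) /= !addr0.
    exact: balancedDr balB _ _ _.
  by rewrite pFrobenius_autE mulrA (balancedZ balB).
- by [].
- by move=> s t _ IH c; rewrite IH.
- by move=> s t u _ IHst _ IHtu c; rewrite IHst IHtu.
- by move=> s s' t t' _ IHs _ IHt c; rewrite !big_cat /= IHs IHt.
- by move=> s t c; rewrite !big_cat /= addrC.
- move=> a s t _ IH c; have := IH (c * a).
  rewrite !big_map /= => E.
  under eq_bigr do rewrite mulrA; rewrite E.
  by under eq_bigr do rewrite -mulrA.
- move=> a b g c.
  by rewrite !(big_cons, big_nil) /= !addr0 mulrDr (balancedDl balB).
- by move=> g c; rewrite !(big_cons, big_nil) /= addr0 mulr0 (balanced0l balB).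
Qed.

(** The additive map induced on F(M) by a balanced B.  It need not be R-linear,
    since the maps of interest alter polynomial coefficients, so [pres_lift] does
    not apply.  Summing over a representative makes additivity in B immediate. *)
Definition tensor_lift (M : lmodType R) (V : zmodType) (B : R -> M -> V)
    (x : Frob hp M) : V := \sum_(y <- repr x) B y.1 y.2.

Lemma tensor_lift_class (M : lmodType R) (V : zmodType) (B : R -> M -> V) s :
  balanced p B -> tensor_lift B (pres_class _ s) = \sum_(y <- s) B y.1 y.2.
Proof.
move=> balB.
have := balanced_sum_cong balB (pres_repr _ s) 1.
under eq_bigr do rewrite mul1r; move=> E; rewrite /tensor_lift E.
by under eq_bigr do rewrite mul1r.
Qed.

Lemma tensor_lift_pure (M : lmodType R) (V : zmodType) (B : R -> M -> V) r m :
  balanced p B -> tensor_lift B (pure_tensor _ r m) = B r m.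
Proof. by move=> balB; rewrite tensor_lift_class // big_cons big_nil addr0. Qed.

Lemma tensor_liftD (M : lmodType R) (V : zmodType) (B : R -> M -> V) x y :
  balanced p B -> tensor_lift B (x + y) = tensor_lift B x + tensor_lift B y.
Proof.
move=> balB; elim/presW: x => s; elim/presW: y => t.
by rewrite -pres_class_cat !tensor_lift_class // big_cat.
Qed.

Lemma tensor_liftZ (M : lmodType R) (V : zmodType) (B : R -> M -> V) a x :
  balanced p B ->
  tensor_lift B (a *: x) = tensor_lift (fun r m => B (a * r) m) x.
Proof.
move=> balB.
have balB' : balanced p (fun r m => B (a * r) m).
  by split=> *; rewrite ?mulrDr ?mulrA; case: balB.
elim/presW: x => s.
by rewrite -pres_class_scale !tensor_lift_class // big_map.
Qed.

Variable M : Fmodule hp.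

Lemma Fmod_frob_subproof (m : M) :
  exists m', Fmod_theta M m' = pure_tensor (pFrobenius_aut hp) 1 m.
Proof. by case: (Fmod_theta_bij M) => g _ gK; exists (g (pure_tensor _ 1 m)). Qed.

Definition Fmod_frob (m : M) : M := sval (cid (Fmod_frob_subproof m)).

Lemma Fmod_thetaE m :
  Fmod_theta M (Fmod_frob m) = pure_tensor (pFrobenius_aut hp) 1 m.
Proof. by rewrite /Fmod_frob; case: cid. Qed.

Lemma Fmod_theta_inj : injective (Fmod_theta M).
Proof. exact: bij_inj (Fmod_theta_bij M). Qed.

Lemma Fmod_frobD : {morph Fmod_frob : x y / x + y}.
Proof.
move=> x y; apply: Fmod_theta_inj; rewrite linearD !Fmod_thetaE.
by rewrite /pure_tensor -pres_class_cat; apply/pres_classP/pres_rel/tensor_addr.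
Qed.

Lemma Fmod_frob0 : Fmod_frob 0 = 0.
Proof. by apply: (addrI (Fmod_frob 0)); rewrite -Fmod_frobD !addr0. Qed.

Lemma Fmod_frobZ a x : Fmod_frob (a *: x) = a ^+ p *: Fmod_frob x.
Proof.
apply: Fmod_theta_inj; rewrite linearZ !Fmod_thetaE [RHS]pure_tensorZ mulr1.
apply/pres_classP/pres_sym/pres_rel.
by have := tensor_balanced (pFrobenius_aut hp) 1 a x; rewrite mul1r.
Qed.

Lemma iter_Fmod_frobD e : {morph iter e Fmod_frob : x y / x + y}.
Proof. by move=> x y; elim: e => //= e ->; rewrite Fmod_frobD. Qed.

Lemma iter_Fmod_frobZ e a x :
  iter e Fmod_frob (a *: x) = a ^+ (p ^ e) *: iter e Fmod_frob x.
Proof.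
elim: e => [|e IH] //=.
by rewrite IH Fmod_frobZ -exprM -expnSr.
Qed.

(** The universal property of M = F^e(M), phrased on relations: a balanced B
    factors through r *: phi^e m.  For e.+1, freeze r: precomposing B with
    r' |-> r * r' ^+ (p ^ e) gives a map balanced for p, which descends to M
    through theta; letting r vary again gives a map balanced for p ^ e, to which
    induction applies. *)
Lemma Fmod_frob_sum_eq0 (V : zmodType) e (B : R -> M -> V) s :
  balanced (p ^ e) B ->
  \sum_(y <- s) y.1 *: iter e Fmod_frob y.2 = 0 ->
  \sum_(y <- s) B y.1 y.2 = 0.
Proof.
elim: e B s => [|e IH] B s balB s0.
  (* Over q = 1, balanced means that B r m is B 1 (r *: m). *)
  pose B1 := B 1; have B10 : B1 0 = 0 by rewrite /B1 (balanced0r balB).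
  have B1D : {morph B1 : x y / x + y} by move=> x y; apply: balancedDr balB _ _ _.
  rewrite -[RHS]B10 -s0 (big_morph B1 B1D B10); apply: eq_bigr => y _.
  by rewrite /B1 /= -(balancedZ balB) mul1r expr1.
pose C r r' m := B (r * r' ^+ (p ^ e)) m.
have pE (x y : R) : (x + y) ^+ (p ^ e) = x ^+ (p ^ e) + y ^+ (p ^ e).
  by apply: exprDn_pchar; rewrite pnatX pnatE ?hp // (pcharf_prime hp).
have balC r : balanced p (C r).
  split=> [r1 r2 m|r1 m m'|r1 a m]; rewrite /C.
  - by rewrite pE mulrDr (balancedDl balB).
  - exact: balancedDr balB _ _ _.
  - by rewrite exprMn -exprM -expnS mulrA (balancedZ balB).
pose D r m := tensor_lift (C r) (Fmod_theta M m).
have balD : balanced (p ^ e) D.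
  split=> [r1 r2 m|r m m'|r a m]; rewrite /D.
  - rewrite /tensor_lift -big_split; apply: eq_bigr => y _.
    by rewrite /C mulrDl (balancedDl balB).
  - by rewrite linearD tensor_liftD.
  - rewrite linearZ tensor_liftZ // /tensor_lift; apply: eq_bigr => y _.
    by rewrite /C exprMn mulrA.
rewrite -[RHS](IH D [seq (y.1, Fmod_frob y.2) | y <- s] balD).
  rewrite big_map; apply: eq_bigr => y _ /=.
  by rewrite /D Fmod_thetaE tensor_lift_pure // /C expr1n mulr1.
by rewrite big_map -[RHS]s0; apply: eq_bigr => y _; rewrite iterSr.
Qed.

End FrobeniusStructure.

(** * Degrees under the Frobenius-linear map *)

Section GradedFrobenius.
Local Open Scope ring_scope.
Variables (n : nat) (R : comNzRingType) (gR : multideg n -> R -> Prop).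
Variables (p : nat) (hp : p \in [pchar R]).

Lemma Frob_map_degree (M N : lmodType R) gM gN (f : {linear M -> N}) :
  degree_preserving gM gN f ->
  degree_preserving (Frob_grading gR (hp := hp) gM) (Frob_grading gR gN)
    (Frob_map hp f).
Proof.
move=> hf u x [s [hs ->]]; exists [seq (y.1, f y.2) | y <- s]; split.
  move=> _ /mapP[y /hs[a [b [ha hb ->]]] ->].
  by exists a, b; split=> //; apply: hf.
rewrite linear_sum big_map; apply: eq_bigr => y _.
exact: tensor_mapE.
Qed.

(** The transition maps of the direct system are homogeneous, so a homogeneous
    element of M may be represented at a positive level, where the compatibility
    of theta with the shift applies. *)
Lemma Frob_iter_map_degree (U : lmodType R) gU (beta : {linear U -> Frob hp U}) e :
  degree_preserving gU (Frob_grading gR gU) beta ->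
  degree_preserving (Frob_iter_grading gR gU (e := e))
    (Frob_iter_grading gR gU (e := e.+1)) (Frob_iter_map beta e).
Proof. by move=> hb; elim: e => //= e IH; apply: Frob_map_degree. Qed.

Lemma Frob_lim_in_step (U : lmodType R) (beta : {linear U -> Frob hp U}) e x :
  Frob_lim_in beta e.+1 (Frob_iter_map beta e x) = Frob_lim_in beta e x.
Proof. apply/esym/pres_classP/pres_rel; exact: dirlim_step. Qed.

Variables (M : Fmodule hp) (gM : multideg n -> M -> Prop).
Hypothesis gradedM : graded_F_finite gR gM.
Hypothesis gR1 : gR 0 1.
Hypothesis gRM : forall a b r s, gR a r -> gR b s -> gR (a + b) (r * s).

Lemma graded_exp e a r : gR a r -> gR (a *+ e) (r ^+ e).
Proof. by move=> ar; elim: e => // e IH; rewrite mulrS exprS; apply: gRM. Qed.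

Lemma Fmod_frob_degree u m : gM u m -> gM (u *+ p) (Fmod_frob m).
Proof.
case: gradedM => _ [U [gU [beta [_ _ _ [phi [_ shift gMP]]]]]].
move=> /gMP[e [x [hx ->]]]; apply/gMP.
exists e.+1, (pure_tensor (pFrobenius_aut hp) 1 x); split.
  exists [:: (1, x)]; split; last by rewrite big_seq1.
  by move=> y; rewrite inE => /eqP->; exists 0, u; split; rewrite ?add0r.
by apply: (@Fmod_theta_inj _ _ _ M); rewrite Fmod_thetaE shift [RHS]tensor_mapE.
Qed.

Lemma Fmod_frob_span u m : gM u m ->
  exists s : seq (R * M),
    (forall y, y \in s -> exists a b, [/\ gR a y.1, gM b y.2 & u = a + b *+ p]) /\
    m = \sum_(y <- s) y.1 *: Fmod_frob y.2.
Proof.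
case: gradedM => _ [U [gU [beta [_ _ hbeta [phi [_ shift gMP]]]]]].
move=> /gMP[e [x [hx ->]]].
have [s [hs sE]] := Frob_iter_map_degree hbeta hx.
pose f y := phi (Frob_lim_in beta e y).
exists [seq (y.1, f y.2) | y <- s]; split.
  move=> _ /mapP[y /hs[a [b [ha hb ->]]] ->]; exists a, b; split=> //.
  by apply/gMP; exists e, y.2.
apply: (@Fmod_theta_inj _ _ _ M).
rewrite -Frob_lim_in_step shift sE !linear_sum big_map; apply: eq_bigr => y _.
by rewrite linearZ Fmod_thetaE [RHS]pure_tensorZ mulr1 [LHS]tensor_mapE.
Qed.

(** Substituting the one-step expression into itself: phi (r *: x) is
    r ^+ p *: phi x, which is why the homogeneous coefficients must be closed
    under powers and products. *)
Lemma Fmod_frob_iter_span e u m : gM u m ->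
  exists s : seq (R * M),
    (forall y, y \in s ->
       exists a b, [/\ gR a y.1, gM b y.2 & u = a + b *+ (p ^ e)]) /\
    m = \sum_(y <- s) y.1 *: iter e (@Fmod_frob _ _ _ M) y.2.
Proof.
elim: e u m => [|e IH] u m um.
  exists [:: (1, m)]; split; last by rewrite big_seq1 scale1r.
  by move=> y; rewrite inE => /eqP->; exists 0, u; split; rewrite ?add0r ?mulr1n.
have [s [hs ->]] := Fmod_frob_span um.
elim: s hs => [|[r x] s IHs] hs.
  by exists [::]; rewrite !big_nil; split.
have [y ys|t [ht tE]] := IHs; first by apply: hs; rewrite inE ys orbT.
have [a [b [ar bx uE]]] := hs (r, x) (mem_head _ _).
have [t' [ht' /= xE]] := IH _ _ bx.
exists ([seq (r * y.1 ^+ p, y.2) | y <- t'] ++ t); split.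
  move=> y; rewrite mem_cat => /orP[/mapP[z /ht'[a' [b' [az bz bE]]] ->]|/ht//].
  exists (a + a' *+ p), b'; split=> //; first exact/gRM/graded_exp.
  by rewrite uE bE mulrnDl -mulrnA -expnSr addrA.
rewrite big_cons big_cat /= -tE; congr (_ + _).
rewrite xE (big_morph _ (@Fmod_frobD _ _ _ M) (@Fmod_frob0 _ _ _ M)) scaler_sumr.
rewrite big_map; apply: eq_bigr => z _.
by rewrite Fmod_frobZ scalerA.
Qed.

Lemma Fmod_frob_iter_degree e u m :
  gM u m -> gM (u *+ p ^ e) (iter e (@Fmod_frob _ _ _ M) m).
Proof.
move=> um; elim: e => [|e IH] //=.
by rewrite expnSr mulrnA; apply: Fmod_frob_degree.
Qed.

End GradedFrobenius.

(** * Replacing residues of exponents in a polynomial *)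

Section ResidueReplacement.
Local Open Scope ring_scope.
Variables (A : comNzRingType) (n : nat).
Implicit Types (f g a : {mpoly A[n]}) (r m k : 'X_{1..n}) (u v b : multideg n).

(** Exponents keep their quotient by q and get the prescribed remainder r.
    Forgetting the old remainder, instead of selecting the exponents with a given
    one, keeps the operation total and commuting with multiplication by q-th
    powers. *)
Definition mnm_rebase (q : nat) r m : 'X_{1..n} :=
  [multinom (m i %/ q * q + r i)%N | i < n].

Definition rebase (q : nat) r f : {mpoly A[n]} :=
  \sum_(m <- msupp f) f@_m *: 'X_[mnm_rebase q r m].

Lemma rebaseE q r f d : (msize f <= d)%N ->
  rebase q r f = \sum_(m : 'X_{1..n < d}) f@_m *: 'X_[mnm_rebase q r m].
Proof.
move=> fd; rewrite /rebase (big_mksub ('X_{1..n < d} : subFinType _)) //=.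
- by rewrite big_rmcond //= => m /memN_msupp_eq0 ->; rewrite scale0r.
- exact: msupp_uniq.
- by move=> m /msize_mdeg_lt /leq_trans; apply.
Qed.

Lemma rebaseD q r f g : rebase q r (f + g) = rebase q r f + rebase q r g.
Proof.
pose d := maxn (msize (f + g)) (maxn (msize f) (msize g)).
rewrite !(@rebaseE _ _ _ d) ?leq_max ?leqnn ?orbT // -big_split.
by apply: eq_bigr => m _; rewrite mcoeffD scalerDl.
Qed.

Lemma rebase0 q r : rebase q r 0 = 0.
Proof. by rewrite /rebase msupp0 big_nil. Qed.

Lemma rebaseX q r c m : rebase q r (c *: 'X_[m]) = c *: 'X_[mnm_rebase q r m].
Proof.
have [->|c0] := eqVneq c 0; first by rewrite !scale0r rebase0.
have cm : (c *: 'X_[m] : {mpoly A[n]})@_m = c.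
  by rewrite mcoeffZ mcoeffX eqxx mulr1.
have mS : m \in msupp (c *: 'X_[m] : {mpoly A[n]}).
  by rewrite mcoeff_msupp cm.
rewrite /rebase (bigD1_seq m) ?msupp_uniq //= cm big_seq_cond big1 ?addr0 // => m'.
by case/andP=> /msuppZ_le; rewrite msuppX inE => ->.
Qed.

Lemma mnm_rebaseM q r m k : (0 < q)%N ->
  mnm_rebase q r (m + k *+ q)%MM = (mnm_rebase q r m + k *+ q)%MM.
Proof.
move=> q0; apply/mnmP => i.
by rewrite !(mnmE, mnmDE, mulmnE) divnDMl // mulnDl addnAC.
Qed.

(** Linearity over q-th powers: q is a power of the characteristic, so a ^+ q
    only has exponents divisible by q, which do not affect remainders. *)
Lemma rebase_expM p e r f a : p \in [pchar {mpoly A[n]}] ->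
  rebase (p ^ e) r (f * a ^+ (p ^ e)) = rebase (p ^ e) r f * a ^+ (p ^ e).
Proof.
move=> hp; have p_pr := pcharf_prime hp.
have q0 : (0 < p ^ e)%N by rewrite expn_gt0 prime_gt0.
have qD x y : (x + y) ^+ (p ^ e) = x ^+ (p ^ e) + y ^+ (p ^ e) :> {mpoly A[n]}.
  by apply: exprDn_pchar; rewrite pnatX pnatE ?hp.
elim/mpolyind: a => [|c k a _ _ IHa].
  by rewrite expr0n eqn0Ngt q0 !mulr0 rebase0.
rewrite qD !mulrDr rebaseD {}IHa; congr (_ + _).
elim/mpolyind: f => [|d m f _ _ IHf]; first by rewrite !(mul0r, rebase0).
rewrite mulrDl !rebaseD mulrDl {}IHf; congr (_ + _).
rewrite exprZn mpolyXn -!scalerAr -!scalerAl !scalerA -mpolyXD !rebaseX.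
by rewrite -scalerAl scalerA -mpolyXD mnm_rebaseM.
Qed.

Lemma mnm_deg_inj : injective (@mnm_deg n).
Proof. by move=> m k /ffunP E; apply/mnmP => i; have := E i; rewrite !ffunE => -[]. Qed.

Lemma mnm_degD m k : mnm_deg (m + k)%MM = mnm_deg m + mnm_deg k.
Proof. by apply/ffunP => i; rewrite !ffunE mnmDE PoszD. Qed.

Lemma mpoly_gradingX c m : mpoly_grading (mnm_deg m) (c *: 'X_[m] : {mpoly A[n]}).
Proof. by move=> k /msuppZ_le; rewrite msuppX inE => /eqP->. Qed.

Lemma mpoly_grading_monomial u f : mpoly_grading u f ->
  f = 0 \/ exists c m, f = c *: 'X_[m] /\ mnm_deg m = u.
Proof.
move=> fu; case: (eqVneq f 0) => [|f0]; [by left | right].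
case E: (msupp f) => [|m s]; first by move/eqP: E; rewrite msupp_eq0 (negPf f0).
have mf : m \in msupp f by rewrite E mem_head.
exists f@_m, m; split; last exact: fu.
rewrite {1}[f]mpolyE (bigD1_seq m) ?msupp_uniq //= big_seq_cond big1 ?addr0 //.
move=> k /andP[kf /eqP[]]; apply: mnm_deg_inj.
by rewrite (fu _ kf) (fu _ mf).
Qed.

Lemma mpoly_gradingM u v f g :
  mpoly_grading u f -> mpoly_grading v g -> mpoly_grading (u + v) (f * g).
Proof.
move=> /mpoly_grading_monomial[->|[c [m [-> <-]]]].
  by move=> _ k; rewrite mul0r msupp0.
move=> /mpoly_grading_monomial[->|[d [k [-> <-]]]].
  by move=> ?; rewrite mulr0 msupp0.
rewrite -scalerAl -scalerAr scalerA -mpolyXD -mnm_degD; exact: mpoly_gradingX.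
Qed.

Lemma mpoly_grading1 : mpoly_grading 0 (1 : {mpoly A[n]}).
Proof. by move=> m; rewrite msupp1 inE => /eqP->; apply/ffunP => i; rewrite !ffunE mnm0E. Qed.

Lemma divn_residue (q r k : nat) (d : int) : (r < q)%N -> k%:Z = r%:Z + d * q%:Z ->
  (k %/ q * q + r = k)%N /\ (k %/ q * q)%:Z = d * q%:Z.
Proof.
move=> rq E; have kr : (k %% q)%N = r.
  apply/eqP; rewrite -eqz_nat -modz_nat E addrC modzMDl modz_nat modn_small //.
have := divn_eq k q; rewrite kr => E'; split=> //.
by apply: (addrI r%:Z); rewrite -E {2}E' PoszD addrC.
Qed.

(** If k + q c = r + q b with r a reduced residue, then k has residue r, although
    c may have negative entries; replacing r by r' in k turns r + q b into
    r' + q b. *)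
Lemma mnm_rebase_residue q r r' k b c : (forall i, (r i < q)%N) ->
  mnm_deg k + c *+ q = mnm_deg r + b *+ q ->
  mnm_rebase q r k = k /\
  mnm_deg (mnm_rebase q r' k) + c *+ q = mnm_deg r' + b *+ q.
Proof.
move=> rq E.
have Ei i : (k i %/ q * q + r i = k i)%N /\
            (k i %/ q * q)%:Z = (b i - c i) * q%:Z.
  apply: divn_residue => //; have /ffunP/(_ i) := E; rewrite !ffunE !ffunMnE.
  by rewrite mulrBl !pmulrn !mulrzz addrA => <-; rewrite addrK.
split; first by apply/mnmP => i; rewrite mnmE; case: (Ei i).
apply/ffunP => i; rewrite !ffunE !ffunMnE mnmE PoszD.
by case: (Ei i) => _ ->; rewrite mulrBl !pmulrn !mulrzz addrAC subrK addrC.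
Qed.

Lemma mnm_rebaseK q r r' k : (forall i, (r' i < q)%N) ->
  mnm_rebase q r (mnm_rebase q r' k) = mnm_rebase q r k.
Proof.
move=> rq; apply/mnmP => i; have q0 : (0 < q)%N by apply: leq_ltn_trans (rq i).
by rewrite !mnmE divnMDl // (divn_small (rq i)) addn0.
Qed.

End ResidueReplacement.

(** * Degrees of a block in base q *)

Section Blocks.
Local Open Scope ring_scope.
Variable n : nat.

Definition block_corner (W : {set 'I_n}) : multideg n :=
  [ffun i => if i \in W then 0 else -1].

Lemma block_cornerP W : block W (block_corner W).
Proof. by move=> i; rewrite !ffunE; case: (i \in W); rewrite lexx. Qed.

(** The base-q digit of a negative coordinate u i > - q is q + u i, with
    quotient -1. *)
Lemma block_digits (W : {set 'I_n}) (q : nat) u : block W u ->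
  (forall i, (`|u i| < q)%N) ->
  exists2 r : 'X_{1..n}, forall i, (r i < q)%N &
    u = mnm_deg r + block_corner W *+ q.
Proof.
move=> Wu uq.
exists [multinom (if i \in W then `|u i| else q - `|u i|)%N | i < n].
  move=> i; rewrite mnmE; have := Wu i; have := uq i.
  by case: (i \in W); lia.
apply/ffunP => i; rewrite !ffunE ffunMnE ffunE mnmE.
have := Wu i; have := uq i; case: (i \in W) => uqi ui.
  by rewrite mul0rn addr0; move: (u i) uqi ui => x; lia.
by rewrite pmulrn mulrzz; move: (u i) uqi ui => x; lia.
Qed.

End Blocks.

(** * Comparing graded components *)

Section Comparison.
Local Open Scope ring_scope.
Variables (A : comNzRingType) (n p : nat) (hp : p \in [pchar {mpoly A[n]}]).
Variables (M : Fmodule hp) (gM : multideg n -> M -> Prop).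
Hypothesis gradedM : graded_F_finite (@mpoly_grading A n) gM.

(** M_u only depends on the floor of u / p ^ e.  The replacement of r by r' and
    then of r' by r is the identity on coefficients of M_u, so if the image of m
    in degree u' vanished, then [Fmod_frob_sum_eq0] applied to the second
    replacement would give m = 0. *)
Lemma nonzero_component_congr e (r r' : 'X_{1..n}) b :
  (forall i, (r i < p ^ e)%N) -> (forall i, (r' i < p ^ e)%N) ->
  nonzero_component gM (mnm_deg r + b *+ (p ^ e)) ->
  nonzero_component gM (mnm_deg r' + b *+ (p ^ e)).
Proof.
move=> rq r'q [m um m0].
have [gM0 gMB gMZ _ _] := gradedM.1.
have gMD u x y : gM u x -> gM u y -> gM u (x + y).
  by move=> ux uy; rewrite -[y]opprK; apply: (gMB) => //; rewrite -[- y]add0r; apply: gMB.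
pose F := iter e (@Fmod_frob _ _ _ M).
have [s [hs mE]] := Fmod_frob_iter_span gradedM (@mpoly_grading1 A n)
  (@mpoly_gradingM A n) e um.
exists (\sum_(y <- s) rebase (p ^ e) r' y.1 *: F y.2).
  rewrite big_seq; apply: big_ind => [||y /hs[a [c [ya yc E]]]]; [exact: gM0|exact: gMD|].
  case/mpoly_grading_monomial: ya => [->|[d [k [-> kE]]]].
    by rewrite rebase0 scale0r; exact: gM0.
  rewrite -kE in E; have [_ <-] := mnm_rebase_residue r' rq (esym E).
  rewrite rebaseX; apply: gMZ; first exact: mpoly_gradingX.
  exact: (Fmod_frob_iter_degree gradedM (@mpoly_grading1 A n)).
move=> m'0; apply: m0.
have balB : balanced (p ^ e) (fun f x => rebase (p ^ e) r f *: F x).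
  split=> [f g x|f x y|f a x].
  - by rewrite rebaseD scalerDl.
  - by rewrite /F iter_Fmod_frobD scalerDr.
  - by rewrite rebase_expM // /F iter_Fmod_frobZ scalerA.
have := Fmod_frob_sum_eq0
  (s := [seq (rebase (p ^ e) r' y.1, y.2) | y <- s]) balB.
rewrite !big_map => /(_ m'0) /= <-; rewrite mE.
apply: eq_big_seq => y /hs[a [c [ya _ E]]].
case/mpoly_grading_monomial: ya => [->|[d [k [-> kE]]]]; first by rewrite !rebase0.
rewrite -kE in E; have [kK _] := mnm_rebase_residue r' rq (esym E).
by rewrite !rebaseX mnm_rebaseK // kK.
Qed.

End Comparison.

Theorem theoremB (A : comNzRingType) (k : fieldType) (p : nat)
    (iota : {rmorphism k -> A}) (hk : p \in [pchar k]%R) (n : nat)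
    (M : Fmodule (pchar_mpoly n iota hk))
    (gM : multideg n -> M -> Prop) (W : {set 'I_n}) :
  regular_ring A ->
  graded_F_finite (@mpoly_grading A n) gM ->
  ((forall u, block W u -> nonzero_component gM u) <->
   (exists2 w, block W w & nonzero_component gM w)).
Proof.
move=> _ gradedM; split=> [Mu|[w Ww Mw] u Wu].
  by exists (block_corner W); [|apply: Mu]; exact: block_cornerP.
(* Any exponent with p ^ e above all coordinates of u and w does. *)
pose e := (\sum_i `|u i| + \sum_i `|w i|)%N.
have lt_e (v : nat) : (v <= e)%N -> (v < p ^ e)%N.
  by move/leq_ltn_trans; apply; rewrite ltn_expl // prime_gt1 // (pcharf_prime hk).
have uq i : (`|u i| < p ^ e)%N.
  by apply: lt_e; rewrite /e (bigD1 i) //= -addnA leq_addr.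
have wq i : (`|w i| < p ^ e)%N.
  by apply: lt_e; rewrite /e addnC (bigD1 i) //= -addnA leq_addr.
have [r rq uE] := block_digits Wu uq; have [r' r'q wE] := block_digits Ww wq.
by rewrite uE; apply: (nonzero_component_congr gradedM r'q rq); rewrite -wE.
Qed.
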